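(* Let $L\in\mathbb{R}^{n\times n}$ be a Laplacian matrix, let $\delta>0$, let $\boldsymbol{v}=(v_1,\ldots,v_n)^{\mathrm T}$ be a vector with nonnegative entries, and put $s=\sum_{i=1}^n v_i$. Let $\boldsymbol{y}(t)=(y_1(t),\ldots,y_{n+1}(t))^{\mathrm T}$, $t\ge 0$, be a solution of $$\dot{\boldsymbol{y}}(t)=-(L_0+H_{\delta,\boldsymbol{v}})\,\boldsymbol{y}(t),$$ where $L_0$ and $H_{\delta,\boldsymbol{v}}$ are the matrices of order $n+1$ defined in the context. Then $$\lim_{t\to\infty}\boldsymbol{y}(t)=\mathbf{1}'\,\frac{1}{s+\delta}\Big[\boldsymbol{v}^{\mathrm T}\big(I+\tfrac1\delta L\big)^{-1}\;\;\delta\Big]\boldsymbol{y}(0).$$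
   Context: A Laplacian matrix is a real square matrix with nonpositive off-diagonal entries and zero row sums. $\mathbf 1$ and $\mathbf 0$ are the all-ones and all-zeros column vectors of length $n$, $\mathbf 1'$ is the all-ones column vector of length $n+1$, and $I$ is the identity matrix of order $n$. Define the matrices of order $n+1$ $$L_0=\begin{pmatrix}L&\mathbf 0\\ \mathbf 0^{\mathrm T}&0\end{pmatrix},\quad H_I=\begin{pmatrix}I&-\mathbf 1\\ \mathbf 0^{\mathrm T}&0\end{pmatrix},\quad H_{\boldsymbol v}=\begin{pmatrix}0_{n\times n}&\mathbf 0\\ -\boldsymbol v^{\mathrm T}&s\end{pmatrix},\quad H_{\delta,\boldsymbol v}=\delta H_I+H_{\boldsymbol v}.$$ For a row vector $u$ of length $n$ and a scalar $c$, $[u\;\;c]$ is the row vector of length $n+1$ obtained by appending $c$ to $u$. *)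

(* Defs.v *)
From HB Require Import structures.
From mathcomp Require Import all_boot all_order all_algebra.
From mathcomp Require Import all_classical all_reals all_analysis.

Set Implicit Arguments.
Unset Strict Implicit.
Unset Printing Implicit Defensive.

Import Order.TTheory GRing.Theory Num.Theory.
Import numFieldNormedType.Exports.

Local Open Scope classical_set_scope.
Local Open Scope ring_scope.

Definition is_laplacian (R : realType) (n : nat) (L : 'M[R]_n) : Prop :=
  (forall i j, i != j -> L i j <= 0) /\ (forall i, \sum_j L i j = 0).

Definition entry_sum (R : realType) (n : nat) (v : 'cV[R]_n) : R :=
  \sum_i v i 0.

Definition L0_mx (R : realType) (n : nat) (L : 'M[R]_n) : 'M[R]_(n + 1) :=
  block_mx L 0 0 0.

Definition HI_mx (R : realType) (n : nat) : 'M[R]_(n + 1) :=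
  block_mx 1%:M (- const_mx 1) 0 0.

Definition Hv_mx (R : realType) (n : nat) (v : 'cV[R]_n) : 'M[R]_(n + 1) :=
  block_mx 0 0 (- v^T) (entry_sum v)%:M.

Definition Hdv_mx (R : realType) (n : nat) (delta : R) (v : 'cV[R]_n) :
    'M[R]_(n + 1) :=
  delta *: HI_mx R n + Hv_mx v.

(* [y] solves y' = A y on [0, +oo[: the derivative is two-sided at t > 0 and
   one-sided at the endpoint 0; the values of [y] at negative times are
   irrelevant. *)
Definition solves_linear_ode (R : realType) (m : nat) (A : 'M[R]_m)
    (y : R -> 'cV[R]_m) : Prop :=
  (h^-1 *: (y h - y 0) @[h --> 0^'+] --> A *m y 0) /\
  (forall t : R, 0 < t -> is_derive t (1 : R) y (A *m y t)).

(* Main.v *)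
(** Write [B] for the system matrix and [z] for the last entry of [y].  At an
    index where [y] is maximal, [B y] is at least [delta * (y_i - z)], and
    symmetrically at a minimal index, so the largest gap [y_i - y_j] satisfies
    [gap' <= - delta * gap] and all gaps decay like [exp (- delta * t)].  The
    row vector [[v^T (I + L / delta)^-1, delta]] is a left null vector of [B]
    with entry sum [s + delta]; its product with [y] is conserved and pins down
    the common limit of the entries. *)
Require Import Defs.
From HB Require Import structures.
From mathcomp Require Import all_boot all_order all_algebra.
From mathcomp Require Import all_classical all_reals all_analysis.
From mathcomp Require Import ring lra.

Set Implicit Arguments.
Unset Strict Implicit.
Unset Printing Implicit Defensive.

Import Order.TTheory GRing.Theory Num.Theory.
Import numFieldNormedType.Exports.

Local Open Scope classical_set_scope.
Local Open Scope ring_scope.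

(** * Maxima of real functions and entrywise limits *)

Lemma derive_ge0_left_max (R : realType) (f : R -> R) (c d : R) :
  is_derive c 1 f d -> (\forall t \near c^'-, f t <= f c) -> 0 <= d.
Proof.
move=> [fc <-] fmax.
rewrite /derive cvg_at_leftE; last exact: fc.
apply: limr_ge; first exact/cvgP/cvg_dnbhs_at_left/fc.
near=> h.
have h0 : h < 0 by near: h; exact: nbhs_left_lt.
apply: mulr_le0; first by rewrite invr_le0 ltW.
rewrite subr_le0 /= [_%:A]mulr1.
near: h.
move: fmax => [e /= e0 He]; exists e => //= h.
rewrite /ball_ /= sub0r normrN => he h0.
apply: He; last by lra.
by rewrite /ball_ /= opprD addrCA subrr addr0 normrN.
Unshelve. all: by end_near. Qed.

(** After a small downward tilt, a joint maximum over indices and times in [[0, t]] at a positive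
    time would have a negative derivative, though its left difference quotients are nonnegative. So
    it sits at time 0, where [C] bounds it. *)
Lemma finite_maximum_principle (R : realType) (I : finType)
    (f f' : I -> R -> R) (C : R) :
  (forall k, f k t @[t --> 0^'+] --> f k 0) ->
  (forall k (t : R), 0 < t -> is_derive t (1 : R) (f k) (f' k t)) ->
  (forall k (t : R), 0 < t -> (forall l, f l t <= f k t) -> f' k t <= 0) ->
  (forall k, f k 0 <= C) -> forall k (t : R), 0 <= t -> f k t <= C.
Proof.
move=> f0 df fmax fC k t; rewrite le_eqVlt => /orP[/eqP <- //|t0].
apply/ler_addgt0Pr => e e0.
(* With this slope the tilt costs exactly [e] at time [t]. *)
pose a := e / t.
have a0 : 0 < a by rewrite divr_gt0.
(* The tilt by [- a * s] makes the derivative at a maximal index negative. *)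
pose g l s := f l s - a * s.
have dg l (s : R) : 0 < s -> is_derive s (1 : R) (g l) (f' l s - a).
  move=> s0; have dfls := df l s s0.
  have -> : g l = f l - (a \*: id) by apply/funext.
  by apply: is_derive_eq; rewrite [a *: 1]mulr1.
have cg l : {within `[0, t], continuous (g l)}.
  have dcont (s : R) : 0 < s -> {for s, continuous (g l)}.
    move=> /(dg l)[dgl _].
    exact/differentiable_continuous/derivable1_diffP.
  apply/continuous_within_itvP => //; split.
  - by move=> s; rewrite in_itv /= => /andP[s0 _]; exact: dcont.
  - apply: cvgB; first exact: f0.
    by apply: cvg_at_right_filter; apply: cvgM; [exact: cvg_cst|exact: cvg_id].
  - by apply: cvg_at_left_filter; exact: dcont.
have /choice[c cP] l : exists c, c \in `[0, t] /\
    forall s, s \in `[0, t] -> g l s <= g l c.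
  by have [c ? ?] := EVT_max (ltW t0) (cg l); exists c.
pose m := [arg max_(l > k) g l (c l)]%O.
have mP l s : s \in `[0, t] -> g l s <= g m (c m).
  move=> st; apply: le_trans ((cP l).2 _ st) _.
  by rewrite /m; case: arg_maxP => //= j _; exact.
have cm0 : c m = 0.
  have [/[!in_itv]/= /andP[+ ct] _] := cP m.
  rewrite le_eqVlt => /orP[/eqP //|cm0].
  (* At a fixed time the tilt is the same for all indices, so [m] also maximizes the untilted family
     there. *)
  have : f' m (c m) <= 0.
    apply: fmax => // l; have := mP l (c m).
    by rewrite in_itv /= ltW //= ct => /(_ isT); rewrite /g lerD2r.
  have : 0 <= f' m (c m) - a.
    apply: (derive_ge0_left_max (dg m (c m) cm0)).
    near=> s; apply: mP; rewrite in_itv /=; apply/andP; split.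
      by near: s; exact: nbhs_left_ge.
    apply: le_trans ct; near: s; exact: nbhs_left_le.
  by lra.
have := mP k t; rewrite cm0 /g mulr0 subr0 in_itv /= lexx ltW //= => /(_ isT).
rewrite divfK ?gt_eqF // => h.
by rewrite -lerBlDr (le_trans h).
Unshelve. all: by end_near. Qed.

Lemma cvg_mxP (R : realType) (T : Type) (F : set_system T) (FF : Filter F)
    (m n : nat) (f : T -> 'M[R]_(m, n)) (l : 'M[R]_(m, n)) :
  (forall i j, f t i j @[t --> F] --> l i j) -> f t @[t --> F] --> l.
Proof.
move=> fl; apply/cvgrPdist_le => /= e e0; near=> x.
rewrite /Num.Def.normr/= mx_normrE (bigmax_le _ (ltW e0))//= => i _.
rewrite !mxE/=; move: i; near: x; apply: filter_forall => /= i.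
by move/cvgrPdist_le : (fl i.1 i.2); exact.
Unshelve. all: by end_near. Qed.

(** * Laplacian matrices and the system matrix *)

Lemma laplacian_mulmx_ge0_at_max (R : realType) (n : nat) (L : 'M[R]_n)
    (x : 'cV[R]_n) (i : 'I_n) :
  is_laplacian L -> (forall j, x j 0 <= x i 0) -> 0 <= (L *m x) i 0.
Proof.
move=> [Loff Lsum] xmax.
have -> : (L *m x) i 0 = \sum_j L i j * (x j 0 - x i 0).
  under eq_bigr do rewrite mulrBr.
  by rewrite sumrB -mulr_suml Lsum mul0r subr0 mxE.
apply: sumr_ge0 => j _; have [->|ij] := eqVneq i j; first by rewrite subrr mulr0.
by apply: mulr_le0; [exact: Loff | rewrite subr_le0].
Qed.

(** At a maximal entry of a kernel vector [x], [x m 0 = - a * (L *m x) m 0 <= 0]. Applied to [x] and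
    [- x], this forces [x = 0]. *)
Lemma laplacian_resolvent_unitmx (R : realType) (n : nat) (L : 'M[R]_n) (a : R) :
  is_laplacian L -> 0 <= a -> 1%:M + a *: L \in unitmx.
Proof.
move=> hL a0.
have ker_le0 (x : 'cV[R]_n) i : (1%:M + a *: L) *m x = 0 -> x i 0 <= 0.
  rewrite mulmxDl mul1mx -scalemxAl => Mx0.
  pose m := [arg max_(k > i) x k 0]%O.
  have xm k : x k 0 <= x m 0 by rewrite /m; case: arg_maxP => // j _; exact.
  have := congr1 (fun w : 'cV_n => w m 0) Mx0; rewrite !mxE -/(x m 0).
  have := laplacian_mulmx_ge0_at_max hL xm; rewrite mxE => /(mulr_ge0 a0) h e.
  by have := xm i; lra.
rewrite -unitmx_tr -row_free_unit; apply: inj_row_free => u uM0.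
have Mu0 : (1%:M + a *: L) *m u^T = 0.
  by apply: trmx_inj; rewrite trmx_mul trmxK uM0 trmx0.
apply: trmx_inj; apply/colP => i; rewrite trmx0 [RHS]mxE.
apply/eqP; rewrite eq_le ker_le0 //=.
have := @ker_le0 (- u^T) i; rewrite mulmxN Mu0 oppr0 => /(_ erefl).
by rewrite mxE oppr_le0.
Qed.

Lemma const_mx1_mulmx (R : pzRingType) (m : nat) (w : 'cV[R]_1) i :
  ((const_mx 1 : 'cV[R]_m) *m w) i 0 = w 0 0.
Proof. by rewrite mxE big_ord1 mxE mul1r. Qed.

Lemma system_mulmx_col (R : realType) (n : nat) (L : 'M[R]_n) (delta : R)
    (v x : 'cV[R]_n) (w : 'cV[R]_1) :
  (L0_mx L + Hdv_mx delta v) *m col_mx x w =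
  col_mx (L *m x + delta *: (x - const_mx 1 *m w))
         (entry_sum v *: w - v^T *m x).
Proof.
rewrite /L0_mx /Hdv_mx /HI_mx /Hv_mx scale_block_mx !add_block_mx mul_block_col.
rewrite !scaler0 !addr0 !add0r; congr col_mx.
  by rewrite mulmxDl -!scalemxAl mul1mx mulNmx -addrA -scalerDr.
by rewrite mulNmx mul_scalar_mx addrC.
Qed.

(* At a maximal entry, the nonpositive off-diagonal entries of the system
   matrix can only help, and the coupling to the last node contributes
   [delta] times the gap to it (zero if the last node is itself maximal). *)
Lemma system_mulmx_ge_at_max (R : realType) (n : nat) (L : 'M[R]_n) (delta : R)
    (v : 'cV[R]_n) (y : 'cV[R]_(n + 1)) (i : 'I_(n + 1)) :
  is_laplacian L -> (forall i, 0 <= v i 0) -> (forall j, y j 0 <= y i 0) ->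
  delta * (y i 0 - y (rshift n 0) 0)
    <= ((L0_mx L + Hdv_mx delta v) *m y) i 0.
Proof.
move=> hL hv; rewrite -[y]vsubmxK system_mulmx_col.
set x := usubmx y; set w := dsubmx y; rewrite col_mxEd.
case: (split_ordP i) => k -> ymax; rewrite ?col_mxEu ?col_mxEd.
  have entryE (a b c : 'cV[R]_n) :
      (a + delta *: (b - c)) k 0 = a k 0 + delta * (b k 0 - c k 0).
    by rewrite !mxE.
  rewrite entryE const_mx1_mulmx lerDr; apply: laplacian_mulmx_ge0_at_max => // j.
  by have := ymax (lshift 1 j); rewrite !col_mxEu.
(* The last row is a combination of gaps with the nonnegative weights [v j 0]. *)
have -> : (entry_sum v *: w - v^T *m x) k 0 = \sum_j v j 0 * (w 0 0 - x j 0).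
  have entryE (a : R) (b c : 'cV[R]_1) : (a *: b - c) k 0 = a * b k 0 - c k 0.
    by rewrite !mxE.
  rewrite entryE (ord1 k) [(v^T *m x) _ _]mxE mulr_suml -sumrB.
  by apply: eq_bigr => j _; rewrite [v^T _ _]mxE mulrBr.
rewrite (ord1 k) subrr mulr0; apply: sumr_ge0 => j _.
rewrite mulr_ge0 // subr_ge0.
by have := ymax (lshift 1 j); rewrite col_mxEu (ord1 k) col_mxEd.
Qed.

Lemma trmx_mulmx_const1 (R : realType) (n : nat) (v : 'cV[R]_n) :
  v^T *m const_mx 1 = (entry_sum v)%:M.
Proof.
apply/rowP => j; rewrite !mxE (ord1 j) eqxx mulr1n.
by apply: eq_bigr => i _; rewrite !mxE mulr1.
Qed.

Lemma resolvent_mulmx_const (R : realType) (n : nat) (L : 'M[R]_n) (a : R) :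
  is_laplacian L -> 0 <= a ->
  invmx (1%:M + a *: L) *m (const_mx 1 : 'cV_n) = const_mx 1.
Proof.
move=> hL a0; have Mu := laplacian_resolvent_unitmx hL a0.
have M1 : (1%:M + a *: L) *m (const_mx 1 : 'cV_n) = const_mx 1.
  rewrite mulmxDl mul1mx -scalemxAl [L *m _](_ : _ = 0) ?scaler0 ?addr0 //.
  apply/colP => i; rewrite !mxE -[RHS](hL.2 i).
  by apply: eq_bigr => j _; rewrite mxE mulr1.
by rewrite -{1}M1 mulKmx.
Qed.

(** The upper left block [L + delta *: 1%:M] is [delta] times the inverted matrix, so the first [n]
    columns cancel; the last one cancels because the inverse fixes the all-ones vector. *)
Lemma system_left_kernel (R : realType) (n : nat) (L : 'M[R]_n) (delta : R)
    (v : 'cV[R]_n) :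
  is_laplacian L -> 0 < delta ->
  row_mx (v^T *m invmx (1%:M + delta^-1 *: L)) delta%:M
    *m (L0_mx L + Hdv_mx delta v) = 0.
Proof.
move=> hL d0; have di0 : 0 <= delta^-1 by rewrite invr_ge0 ltW.
set M := 1%:M + delta^-1 *: L.
have deltaM : L + delta *: 1%:M = delta *: M.
  by rewrite scalerDr scalerA divff ?gt_eqF // scale1r addrC.
rewrite /L0_mx /Hdv_mx /HI_mx /Hv_mx scale_block_mx !add_block_mx mul_row_block.
rewrite !scaler0 !addr0 !add0r deltaM.
rewrite -scalemxAr mulmxKV; last exact: laplacian_resolvent_unitmx.
rewrite scalerN !mulmxN -scalemxAr -mulmxA resolvent_mulmx_const // trmx_mulmx_const1.
by rewrite !mul_scalar_mx subrr scale_scalar_mx addNr row_mx0.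
Qed.

(** * Solutions of linear systems: continuity at 0, invariants, decay *)

Lemma ode_cvg_at0 (R : realType) (m : nat) (A : 'M[R]_m) (y : R -> 'cV[R]_m) :
  solves_linear_ode A y -> y t @[t --> 0^'+] --> y 0.
Proof.
move=> [dy0 _].
have -> : y 0 = y 0 + (0 : R) *: (A *m y 0) by rewrite scale0r addr0.
apply: (@cvg_trans _ (y 0 + t *: (t^-1 *: (y t - y 0)) @[t --> 0^'+])).
  apply: near_eq_cvg; near=> t.
  have t0 : 0 < t by near: t; exact: nbhs_right_gt.
  by rewrite scalerA divff ?gt_eqF // scale1r addrC subrK.
apply: cvgD; first exact: cvg_cst.
by apply: cvgZ => //; apply: cvg_at_right_filter; exact: cvg_id.
Unshelve. all: by end_near. Qed.

Lemma ode_entry_cvg_at0 (R : realType) (m : nat) (A : 'M[R]_m)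
    (y : R -> 'cV[R]_m) i :
  solves_linear_ode A y -> y t i 0 @[t --> 0^'+] --> y 0 i 0.
Proof.
move=> /ode_cvg_at0 hy.
exact: (@cvg_comp _ _ _ y (fun M : 'cV[R]_m => M i 0) _ _ _ hy
  (@coord_continuous _ _ _ i 0 (y 0))).
Qed.

Lemma ode_entry_is_derive (R : realType) (m : nat) (A : 'M[R]_m)
    (y : R -> 'cV[R]_m) i (t : R) :
  solves_linear_ode A y -> 0 < t ->
  is_derive t (1 : R) (fun s => y s i 0) ((A *m y t) i 0).
Proof.
move=> [_ dy] /dy[ydt ydE]; apply: DeriveDef.
  by move/derivable_mxP : ydt => /(_ i 0).
by rewrite -ydE derive_mx // mxE.
Qed.

(** The maximum principle for a single function with zero derivative bounds [p *m y t] above by its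
    initial value; [- p] gives the reverse bound. *)
Lemma ode_invariant (R : realType) (m : nat) (A : 'M[R]_m) (p : 'rV[R]_m)
    (y : R -> 'cV[R]_m) (t : R) :
  p *m A = 0 -> solves_linear_ode A y -> 0 <= t -> p *m y t = p *m y 0.
Proof.
move=> pA0 hy t0.
have le_y0 (q : 'rV[R]_m) : q *m A = 0 -> (q *m y t) 0 0 <= (q *m y 0) 0 0.
  move=> qA0.
  apply: (@finite_maximum_principle R unit (fun _ s => (q *m y s) 0 0)
    (fun _ s => (q *m (A *m y s)) 0 0) _ _ _ _ (fun _ => lexx _) tt t t0).
  - move=> _; rewrite mxE; under eq_fun do rewrite mxE.
    apply: cvg_big => [|k _]; first exact: add_continuous.
    by apply: cvgM; [exact: cvg_cst|exact: ode_entry_cvg_at0 _ hy].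
  - move=> _ s s0.
    have -> : (fun s => (q *m y s) 0 0) = \sum_k (q 0 k \*: (fun s => y s k 0)).
      by apply/funext => r; rewrite mxE fct_sumE.
    rewrite mxE.
    apply: is_derive_sum => k; apply: is_deriveZ.
    exact: ode_entry_is_derive.
  - by move=> _ s _ _; rewrite mulmxA qA0 mul0mx mxE.
apply/rowP => j; rewrite (ord1 j); apply/eqP; rewrite eq_le le_y0 //=.
have /le_y0 : - p *m A = 0 by rewrite mulNmx pA0 oppr0.
by rewrite !mulNmx [leLHS]mxE [leRHS]mxE lerN2.
Qed.

(** The maximum principle is applied to the gaps of all ordered pairs, multiplied by
    [expR (delta * t)]. For the largest gap, the bounds at its two ends are subtracted and the
    reference entry [z] cancels. *)
Lemma ode_gap_decay (R : realType) (m : nat) (A : 'M[R]_m) (delta : R)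
    (z : 'I_m) (y : R -> 'cV[R]_m) :
  (forall (x : 'cV[R]_m) i, (forall j, x j 0 <= x i 0) ->
     (A *m x) i 0 <= - delta * (x i 0 - x z 0)) ->
  solves_linear_ode A y ->
  exists C, forall i j t, 0 <= t ->
    `|y t i 0 - y t j 0| <= C * expR (- (delta * t)).
Proof.
move=> A_max hy.
have A_min (x : 'cV[R]_m) i : (forall j, x i 0 <= x j 0) ->
    - delta * (x i 0 - x z 0) <= (A *m x) i 0.
  move=> xi; have := @A_max (- x) i; rewrite mulmxN !mxE.
  suff xN j : (- x) j 0 <= - x i 0 by move=> /(_ xN); lra.
  by rewrite mxE lerN2.
pose f (k : 'I_m * 'I_m) t := expR (delta * t) * (y t k.1 0 - y t k.2 0).
pose C : R := \sum_i \sum_j `|y 0 i 0 - y 0 j 0|.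
have fC k : f k 0 <= C.
  rewrite /f mulr0 expR0 mul1r (le_trans (ler_norm _)) //.
  rewrite /C (bigD1 k.1) //= (bigD1 k.2) //= -addrA lerDl.
  by rewrite addr_ge0 ?sumr_ge0 // => i _; exact: sumr_ge0.
have fleC : forall k (t : R), 0 <= t -> f k t <= C.
  apply: (@finite_maximum_principle R _ f (fun k t => expR (delta * t) *
    (delta * (y t k.1 0 - y t k.2 0) + ((A *m y t) k.1 0 - (A *m y t) k.2 0)))).
  - move=> k; apply: cvgM.
      apply: cvg_at_right_filter; apply: continuous_comp.
        by apply: cvgM; [exact: cvg_cst|exact: cvg_id].
      exact: continuous_expR.
    by apply: cvgB; exact: ode_entry_cvg_at0 _ hy.
  - move=> k t t0.
    have -> : f k = (expR \o (delta \*: id)) *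
        ((fun s => y s k.1 0) - (fun s => y s k.2 0)) by apply/funext.
    have d1 := ode_entry_is_derive k.1 hy t0.
    have d2 := ode_entry_is_derive k.2 hy t0.
    have de : is_derive t (1 : R) (expR \o (delta \*: id)) (expR (delta * t) * delta).
      by apply: is_derive1_comp; apply: is_derive_eq; exact: mulr1.
    apply: is_derive_eq.
    set a1 := (A *m y t) k.1 0; set a2 := (A *m y t) k.2 0.
    rewrite -[LHS]/(expR (delta * t) * (a1 - a2) +
      (y t k.1 0 - y t k.2 0) * (expR (delta * t) * delta)).
    by ring.
  - move=> [i j] t t0 /= fmax.
    have gapmax p q : y t p 0 - y t q 0 <= y t i 0 - y t j 0.
      by have := fmax (p, q); rewrite /f ler_pM2l ?expR_gt0.
    (* A pair with the largest gap consists of a maximal and a minimal entry. *)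
    have imax p : y t p 0 <= y t i 0 by have := gapmax p j; lra.
    have jmin p : y t j 0 <= y t p 0 by have := gapmax i p; lra.
    rewrite pmulr_rle0 ?expR_gt0 //.
    by have := A_max _ _ imax; have := A_min _ _ jmin; lra.
  - exact: fC.
exists C => i j t t0; rewrite expRN ler_pdivlMr ?expR_gt0 // mulrC.
rewrite -(ger0_norm (expR_ge0 (delta * t))) -normrM ler_norml.
rewrite lerNl -mulrN opprB.
by rewrite (fleC (j, i)) // (fleC (i, j)).
Qed.

(** * Identification of the common limit *)

Theorem theorem1 (R : realType) (n : nat) (L : 'M[R]_n) (delta : R)
    (v : 'cV[R]_n) (y : R -> 'cV[R]_(n + 1))
    (hL : is_laplacian L) (hdelta : 0 < delta) (hv : forall i, 0 <= v i 0)
    (hy : solves_linear_ode (- (L0_mx L + Hdv_mx delta v)) y) :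
  (1%:M + delta^-1 *: L) \in unitmx /\
  y t @[t --> +oo] -->
    const_mx 1 *m
      ((entry_sum v + delta)^-1 *:
         row_mx (v^T *m invmx (1%:M + delta^-1 *: L)) delta%:M) *m
      y 0.
Proof.
have di0 : 0 <= delta^-1 by rewrite invr_ge0 ltW.
split; first exact: laplacian_resolvent_unitmx.
have sd0 : 0 < entry_sum v + delta by rewrite ltr_wpDl // sumr_ge0.
set p := _ *: row_mx _ _.
have pB0 : p *m - (L0_mx L + Hdv_mx delta v) = 0.
  by rewrite mulmxN -scalemxAl system_left_kernel // scaler0 oppr0.
(* The inverse fixes the all-ones vector, so the unscaled row sums to [entry_sum v + delta]. *)
have p1 : \sum_k p 0 k = 1.
  have : p *m const_mx 1 = 1%:M.
    rewrite -scalemxAl -col_mx_const mul_row_col -mulmxA resolvent_mulmx_const //.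
    rewrite trmx_mulmx_const1 mul_scalar_mx.
    rewrite [const_mx 1](_ : _ = 1%:M); last first.
      by apply/rowP => j; rewrite !mxE (ord1 j) eqxx.
    by rewrite scalemx1 -raddfD /= scale_scalar_mx mulVf ?gt_eqF.
  move=> /(congr1 (fun M : 'cV[R]_1 => M 0 0)); rewrite mxE [RHS]mxE eqxx mulr1n => <-.
  by apply: eq_bigr => k _; rewrite [const_mx _ _ _]mxE mulr1.
have [C gapC] : exists C, forall i j t, 0 <= t ->
    `|y t i 0 - y t j 0| <= C * expR (- (delta * t)).
  apply: (ode_gap_decay (z := rshift n 0) _ hy) => x i xmax.
  by rewrite mulNmx mxE mulNr lerN2 system_mulmx_ge_at_max.
have gap0 i j : y t i 0 - y t j 0 @[t --> +oo] --> (0 : R).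
  apply/norm_cvg0P; apply: (@squeeze_cvgr _ _ _ _ (fun=> 0)
      (fun t => C * expR (- (delta * t)))).
  - by near=> t; rewrite normr_ge0 gapC //; near: t; exact: nbhs_pinfty_ge.
  - exact: cvg_cst.
  - rewrite -(mulr0 C); apply: cvgM; first exact: cvg_cst.
    apply: (cvg_comp (fun t => delta * t) (fun t => expR (- t))); last exact: cvgr_expR.
    by apply: gt0_cvgMry => //; exact: cvg_id.
apply: cvg_mxP => i j; rewrite (ord1 j) -mulmxA const_mx1_mulmx.
(* As [p] sums to 1 and [p *m y t] is conserved, each entry of [y t] equals [p *m y 0] plus a
   [p]-weighted sum of gaps, which tends to 0. *)
apply: (@cvg_trans _ ((p *m y 0) 0 0
    + \sum_k p 0 k * (y t i 0 - y t k 0) @[t --> +oo])).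
  apply: near_eq_cvg; near=> t.
  have t0 : 0 <= t by near: t; exact: nbhs_pinfty_ge.
  rewrite -(ode_invariant pB0 hy t0) [(p *m _) _ _]mxE -big_split /=.
  rewrite -[RHS]mul1r -p1 mulr_suml; apply: eq_bigr => k _.
  by rewrite mulrBr addrC subrK.
rewrite -[(p *m y 0) 0 0 in X in _ `=>` X]addr0; apply: cvgD; first exact: cvg_cst.
suff : \sum_k p 0 k * (y t i 0 - y t k 0) @[t --> +oo] --> \sum_k p 0 k * 0.
  by rewrite big1 // => k _; rewrite mulr0.
apply: cvg_big => [|k _]; first exact: add_continuous.
by apply: cvgM; [exact: cvg_cst|exact: gap0].
Unshelve. all: by end_near. Qed.
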